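(* Almost surely, $\omega$ has no points of semi-strict increase or decrease. That is, the set of all $\omega\in\Omega$ for which there exists $t\in[0,\infty)$ that is a point of semi-strict increase or a point of semi-strict decrease for $\omega$ has upper probability $\overline{\mathbb{P}}$ equal to $0$.
   Context: Let $\Omega$ be the set of all continuous functions $\omega:[0,\infty)\to\mathbb{R}$. For $t\in[0,\infty)$, $\mathcal{F}_t$ is the smallest $\sigma$-algebra on $\Omega$ making all functions $\omega\mapsto\omega(s)$, $s\in[0,t]$, measurable, and $\mathcal{F}_\infty:=\sigma(\cup_{t\in[0,\infty)}\mathcal{F}_t)$. Stopping times $\tau:\Omega\to[0,\infty]$ w.r. to $(\mathcal{F}_t)$ and the $\sigma$-algebras $\mathcal{F}_\tau$ are defined as usual. ''Positive'' means $\ge0$. An elementary trading strategy $G$ consists of (a) stopping times $\tau_1\le\tau_2\le\cdots$ with $\lim_{n\to\infty}\tau_n(\omega)=\infty$ for each $\omega\in\Omega$ (the value $\infty$ is allowed), and (b) for each $n=1,2,\ldots$, a bounded $\mathcal{F}_{\tau_n}$-measurable function $h_n:\Omega\to\mathbb{R}$. Given $G$ and an initial capital $c\in\mathbb{R}$, the elementary capital process is $$\mathcal{K}^{G,c}_t(\omega):=c+\sum_{n=1}^\infty h_n(\omega)\bigl(\omega(\tau_{n+1}(\omega)\wedge t)-\omega(\tau_n(\omega)\wedge t)\bigr),\quad t\in[0,\infty).$$ A positive capital process is any process $S$ of the form $S_t(\omega)=\sum_{n=1}^\infty\mathcal{K}^{G_n,c_n}_t(\omega)\in[0,\infty]$,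 where each elementary capital process $\mathcal{K}^{G_n,c_n}$ is positive (for all $t$ and $\omega$) and $\sum_{n=1}^\infty c_n$ converges; $S_0=\sum_n c_n$ does not depend on $\omega$. The upper probability of $E\subseteq\Omega$ is $\overline{\mathbb{P}}(E):=\inf\{S_0 \mid \forall\omega\in\Omega:\ \liminf_{t\to\infty}S_t(\omega)\ge\mathbb{I}_E(\omega)\}$, where $S$ ranges over the positive capital processes and $\mathbb{I}_E$ is the indicator of $E$. A property of $\omega$ holds almost surely if the set of $\omega\in\Omega$ where it fails has upper probability $0$. With $u^+:=\max(u,0)$: $t\in[0,\infty)$ is a point of semi-strict increase for $\omega$ if there exists $\delta>0$ such that $\omega(s)\le\omega(t)<\omega(u)$ for all $s\in((t-\delta)^+,t)$ and $u\in(t,t+\delta)$; it is a point of semi-strict decrease if the same holds with $\omega(s)\ge\omega(t)>\omega(u)$ in place of $\omega(s)\le\omega(t)<\omega(u)$. *)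

(* Defs.v *)
From HB Require Import structures.
From mathcomp Require Import all_boot all_order all_algebra.
From mathcomp Require Import all_classical all_reals all_analysis.

Set Implicit Arguments.
Unset Strict Implicit.
Unset Printing Implicit Defensive.

Import Order.TTheory GRing.Theory Num.Theory.
Import numFieldNormedType.Exports.

Local Open Scope classical_set_scope.
Local Open Scope ring_scope.

Section paths.
Variable R : realType.

Lemma mem_time0 : (0 : R) \in `[0 : R, +oo[%classic.
Proof. by rewrite inE /= in_itv /= lexx. Qed.

Definition time0 : set_type `[0 : R, +oo[ := exist _ 0 mem_time0.

Definition path_space : Type := continuousType (set_type `[0 : R, +oo[) R.

(* The value at a real instant, so that instants can be handled as elements
   of R; negative instants, which are never relevant, are sent to 0. *)
Definition at_time (w : path_space) (t : R) : R := w (insubd time0 t).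

Definition sigma_upto (t : R) : set_system path_space :=
  <<s \bigcup_(s in `[0, t])
        preimage_set_system setT (fun w : path_space => at_time w s)
          (measurable : set (set R)) >>.

Definition sigma_infty : set_system path_space :=
  <<s \bigcup_(t in `[0, +oo[) sigma_upto t >>.

Definition is_stopping_time (tau : path_space -> \bar R) : Prop :=
  (forall w, (0 <= tau w)%E) /\
  (forall t : R, 0 <= t -> sigma_upto t [set w | (tau w <= t%:E)%E]).

Definition sigma_stopped (tau : path_space -> \bar R) : set_system path_space :=
  [set A | sigma_infty A /\
     forall t : R, 0 <= t -> sigma_upto t (A `&` [set w | (tau w <= t%:E)%E])].

Record strategy := Strategy {
  stop : nat -> path_space -> \bar R ;
  bet : nat -> path_space -> R ;
  stop_is_stopping_time : forall n, is_stopping_time (stop n) ;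
  stop_nondecreasing : forall n w, (stop n w <= stop n.+1 w)%E ;
  stop_cvgy : forall w, stop n w @[n --> \oo] --> +oo%E ;
  bet_bounded : forall n, exists M : R, forall w, `|bet n w| <= M ;
  bet_measurable : forall n (B : set R), measurable B ->
    sigma_stopped (stop n) (bet n @^-1` B) }.

(* [Order.min (stop n w) t%:E] lies between 0 and t, so [fine] is exact; for
   every t and w only finitely many terms of the series are nonzero. *)
Definition elementary_capital (G : strategy) (c t : R) (w : path_space) : R :=
  c + limn (series (fun n : nat =>
        bet G n w * (at_time w (fine (Order.min (stop G n.+1 w) t%:E)) -
                     at_time w (fine (Order.min (stop G n w) t%:E))))).

Record positive_capital_process := PositiveCapitalProcess {
  strategies : nat -> strategy ;
  capitals : nat -> R ;
  elementary_capital_ge0 : forall n (t : R) w, 0 <= t ->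
    0 <= elementary_capital (strategies n) (capitals n) t w ;
  capitals_summable : cvgn (series capitals) }.

Definition capital (S : positive_capital_process) (t : R) (w : path_space) :
    \bar R :=
  (\sum_(0 <= n <oo)
     (elementary_capital (strategies S n) (capitals S n) t w)%:E)%E.

Definition initial_capital (S : positive_capital_process) : R :=
  limn (series (capitals S)).

Definition upper_probability (E : set path_space) : \bar R :=
  ereal_inf [set (initial_capital S)%:E | S in
    [set S : positive_capital_process | forall w : path_space,
       ((\1_E w)%:E <= limf_einf (fun t : R => capital S t w) +oo%R)%E]].

(* The conditions on the left and on the right of t are separate: at t = 0
   there is no s, and the condition on the right must still be imposed. *)
Definition semi_strict_increase (w : path_space) (t : R) : Prop :=
  exists2 d : R, 0 < d &
    (forall s, Num.max (t - d) 0 < s < t -> at_time w s <= at_time w t) /\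
    (forall u, t < u < t + d -> at_time w t < at_time w u).

Definition semi_strict_decrease (w : path_space) (t : R) : Prop :=
  exists2 d : R, 0 < d &
    (forall s, Num.max (t - d) 0 < s < t -> at_time w s >= at_time w t) /\
    (forall u, t < u < t + d -> at_time w t > at_time w u).

End paths.

(* Main.v *)
Require Import Defs.
From HB Require Import structures.
From mathcomp Require Import all_boot all_order all_algebra.
From mathcomp Require Import all_classical all_reals all_analysis measurable_realfun.
From mathcomp Require Import ring lra zify.
Import Order.TTheory GRing.Theory Num.Theory.
Import numFieldNormedType.Exports.
Local Open Scope classical_set_scope.
Local Open Scope ring_scope.

(* Let f be w or -w. If t is a point of semi-strict increase of f, then for some
   rational q <= t, some a = 1/(p+1) and some integer B the function f is at most
   f t on [q, t], stays above f t afterwards until it reaches f t + a, and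
   f t <= f q + B a. As a positive capital process is a sum of elementary ones, it
   is enough to find, for each of these countably many events, one positive
   elementary capital process with arbitrarily small initial capital that
   eventually stays above 1 on the event.

   Sample f at the successive times, from q on, at which it has moved by
   eps = a / N. This gives a nearest neighbour walk, for which t becomes a time
   when the walk is at its maximum i <= B N and after which it stays above i until
   it reaches i + N. As in Burdzy's proof of the nonincrease of Brownian motion,
   divide the walk into attempts: an attempt begins when the walk is at its running
   maximum, fails when the walk falls one step below the level x where it began,
   and succeeds when the maximum reaches x + N. Betting H_(y+1) - 1 on the next
   step up (H the harmonic numbers), where x + y is the current maximum, a failed
   attempt loses exactly y, so that all failed attempts together lose at most the
   total climb, of order B N, while a successful attempt wins about N H_N. Hence
   initial capital of order B / H_N suffices to end up with 1. *)

Set Implicit Arguments.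
Unset Strict Implicit.
Unset Printing Implicit Defensive.

(** * The discrete game *)

Section game.
Variables (R : realType) (N K : nat).

(* For a walk X with running maximum M, in an attempt begun at level x: [peak] is
   M, [climb] is M - x and [drawdown] is M - X. After a failed attempt [climb] is
   0 (and so is the stake) until the walk is back at M, where the next one begins. *)
Record position := Position { peak : nat; climb : nat; drawdown : nat }.

(** A position that is not live is frozen, with stake 0. The cap [K] keeps the reserve [K - peak] in
    [worth] nonnegative. *)
Definition live (s : position) : bool := (peak s < K)%N && (climb s < N)%N.

(** An attempt begins at level [peak - climb], so a step down falls below it exactly when
    [climb <= drawdown]. *)
Definition advance (s : position) (up : bool) : position :=
  if ~~ live s then s else
  let: Position p y d := s in
  if up then
    if d is d'.+1 then Position p y d' else Position p.+1 y.+1 0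
  else Position p (if (y <= d)%N then 0 else y) d.+1.

(* [slope y] is H_(y+1) - 1. It is the solution of
   [slope y.+1 * y.+2 = slope y * y.+2 + 1], which is what makes
   [worth] gain exactly one stake when the running maximum increases. *)
Definition slope (y : nat) : R := \sum_(k < y) k.+2%:R^-1.

Definition stake (s : position) : R := if live s then slope (climb s) else 0.

(** [K - peak] is what remains if the current attempt fails: the other term vanishes one step below
    the level where it began. *)
Definition worth (s : position) : R :=
  K%:R - (peak s)%:R + slope (climb s) * ((climb s).+1%:R - (drawdown s)%:R).

Definition coherent (s : position) : bool :=
  [&& (peak s <= K)%N, (climb s <= N)%N,
      (climb s == 0%N) || (drawdown s <= climb s)%N &
      (climb s == N) ==> (drawdown s == 0%N)].

Lemma slope0 : slope 0 = 0.
Proof. by rewrite /slope big_ord0. Qed.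

Lemma slopeS y : slope y.+1 = slope y + y.+2%:R^-1.
Proof. by rewrite /slope big_ord_recr. Qed.

Lemma slope_ge0 y : 0 <= slope y.
Proof. by apply: sumr_ge0 => k _; rewrite invr_ge0. Qed.

Lemma ler_slope y z : (y <= z)%N -> slope y <= slope z.
Proof.
elim: z => [|z IHz]; first by rewrite leqn0 => /eqP->.
rewrite leq_eqVlt => /orP[/eqP->//|]; rewrite ltnS => /IHz; rewrite slopeS => h.
by rewrite (le_trans h)// lerDl invr_ge0.
Qed.

Lemma coherent_advance s b : (0 < N)%N -> coherent s -> coherent (advance s b).
Proof.
move=> N0; rewrite /coherent /advance; case: ifPn => // /negPn; rewrite /live.
case: s b => p y d [] /=; last by case: ifPn; lia.
by case: d => [|d] /=; lia.
Qed.

Lemma worth_advance s b : coherent s ->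
  worth (advance s b) = worth s + (if b then 1 else -1) * stake s.
Proof.
rewrite /worth /stake /advance /coherent; case: (boolP (live s)) => [_|_] /=; last first.
  by rewrite mulr0 addr0.
case: s b => p y d [] /=.
  case: d => [|d] /= _; last by ring.
  have : y.+2%:R != 0 :> R by rewrite pnatr_eq0.
  by rewrite slopeS => h; field.
case: ifPn => yd /= /and4P[_ _ + _]; last by move=> _; ring.
case/orP => [/eqP->|dy]; first by rewrite slope0; ring.
(* A failing attempt is back at the level where it began, so the second term of [worth] is exactly
   one stake, the amount lost. *)
have -> : d = y by lia.
by rewrite slope0; ring.
Qed.

Lemma worth_ge0 s : coherent s -> 0 <= worth s.
Proof.
move=> /and4P[pK _ yd _]; rewrite addr_ge0 ?subr_ge0 ?ler_nat//.
case/orP: yd => [/eqP->|yd]; first by rewrite slope0 mul0r.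
by rewrite mulr_ge0 ?slope_ge0// subr_ge0 ler_nat; lia.
Qed.

Lemma stake_ge0 s : 0 <= stake s.
Proof. by rewrite /stake; case: ifP => // _; exact: slope_ge0. Qed.

Lemma stake_le s : stake s <= slope N.
Proof.
rewrite /stake; case: ifP => [/andP[_ /ltnW/ler_slope]//|_]; exact: slope_ge0.
Qed.

(** A step down costs one stake and leaves a nonnegative [worth]. This bound keeps the capital
    nonnegative between two sampling times. *)
Lemma stake_le_worth s : (0 < N)%N -> coherent s -> stake s <= worth s.
Proof.
move=> N0 cs; have := worth_ge0 (coherent_advance false N0 cs).
by rewrite worth_advance//; lra.
Qed.

Lemma worth_won s : coherent s -> climb s = N -> slope N * N.+1%:R <= worth s.
Proof.
move=> /and4P[pK _ _ yN] sN; move: yN; rewrite /worth sN eqxx => /= /eqP->.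
by rewrite subr0 lerDr subr_ge0 ler_nat.
Qed.

Lemma won_frozen s b : climb s = N -> advance s b = s.
Proof. by move=> sN; rewrite /advance /live sN ltnn andbF. Qed.

Lemma stake_won s : climb s = N -> stake s = 0.
Proof. by move=> sN; rewrite /stake /live sN ltnn andbF. Qed.

Variables (b : nat -> bool).

Fixpoint walk (n : nat) : int :=
  if n is m.+1 then walk m + (if b m then 1 else -1) else 0.

Fixpoint play (n : nat) : position :=
  if n is m.+1 then advance (play m) (b m) else Position 0 0 0.

Lemma coherent_play n : (0 < N)%N -> coherent (play n).
Proof.
by move=> N0; elim: n => [|n IHn]; [rewrite /coherent /=; lia|exact: coherent_advance].
Qed.

Lemma won_stays m n : (m <= n)%N -> climb (play m) = N -> play n = play m.
Proof.
move=> /subnKC <-; elim: (n - m)%N => [|k IHk]; first by rewrite addn0.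
by move=> hm; rewrite addnS /= IHk// won_frozen.
Qed.

(** Unless an attempt has succeeded before, the peak is at most [walk m] up to time [m]; so at time
    [m] the walk is at its peak, and the attempt then in progress began at or below [walk m]. As the
    walk stays at or above [walk m] until [n], this attempt cannot fail, and a rise by [N] completes
    it. The bound by [K] excludes an earlier freeze at the cap. *)
Lemma increase_won (m n : nat) : (0 < N)%N -> (m <= n)%N ->
  (forall k, (k <= m)%N -> walk k <= walk m) ->
  (forall k, (m <= k <= n)%N -> walk m <= walk k) ->
  walk m + N%:Z <= walk n -> walk m + N%:Z <= K%:Z -> climb (play n) = N.
Proof.
move=> N0 mn below above far lowK.
have before k : (k <= m)%N -> climb (play k) = N \/
    walk k = (peak (play k))%:Z - (drawdown (play k))%:Z /\ (peak (play k))%:Z <= walk m.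
  elim: k => [|k IHk] km; first by right; have /= := below 0%N isT; split; [|lia].
  case: (IHk (ltnW km)) => [won|[wk pk]]; first by left; rewrite /= won_frozen.
  have := below _ km; have := coherent_play k N0.
  move: wk pk; rewrite /= /coherent /advance /live.
  case: (play k) => p y d /= wk pk + bel.
  by case: ifPn => /= ?; case: (b k) bel => //= bel; [lia|lia|case: d wk => [|d] /=; lia|lia].
case: (before m (leqnn m)) => [won|[wm pm]]; first by rewrite (won_stays mn won).
have after k : (m <= k <= n)%N -> climb (play k) = N \/
    walk k = (peak (play k))%:Z - (drawdown (play k))%:Z /\
    (peak (play k))%:Z <= walk m + (climb (play k))%:Z.
  elim: k => [|k IHk] mkn.
    have m0 : m = 0%N by lia.
    by right; subst m; lia.
  have [mk|mk] := eqVneq m k.+1; first by right; subst m; lia.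
  case: IHk => [|won|[wk pk]]; first lia.
    by left; rewrite /= won_frozen.
  have := above _ mkn; have := coherent_play k N0.
  move: wk pk; rewrite /= /coherent /advance /live.
  case: (play k) => p y d /= wk pk + bel.
  case: ifPn => /= ?; case: (b k) bel => //= bel; [lia|lia| |].
    by case: d wk => [|d] /=; lia.
  by case: ifPn; lia.
have := coherent_play n N0; rewrite /coherent.
by case: (after n) => [|//|]; lia.
Qed.

End game.

(** The partial sums of the harmonic series are [1 + slope]; bounded slopes would make it
    converge. *)
Lemma slope_unbounded (R : realType) (A : R) : exists2 N, (0 < N)%N & A < slope R N.
Proof.
apply: contrapT => h; have {}h N : (0 < N)%N -> slope R N <= A.
  by move=> N0; rewrite leNgt; apply/negP => AN; apply: h; exists N.
apply: (@dvg_harmonic R); apply: nondecreasing_is_cvgn.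
  apply/nondecreasing_seqP => n; rewrite seriesSr.
  by rewrite lerDl harmonic_ge0.
exists (A + 1) => _ [[|n] _ <-].
  by rewrite /series /= big_geq//; have := h 1%N isT; have := slope_ge0 R 1; lra.
rewrite /series /= big_mkord big_ord_recl /= invr1 addrC lerD2r.
have [->|/lt0n_neq0] := posnP n; last by rewrite -lt0n => /h.
by rewrite big_ord0; have := h 1%N isT; have := slope_ge0 R 1; lra.
Qed.

(** * Successive exit times of a continuous function *)

Section exits.
Variables (R : realType) (eps : R) (f : R -> R).

(** From [tau = +oo] no real [u] is admissible, and the value is [+oo] again. *)
Definition exit_time (tau : \bar R) : \bar R :=
  ereal_inf [set u%:E | u in
    [set u : R | (tau <= u%:E)%E /\ `|f u - f (fine tau)| = eps]].

Definition exits (q : R) (n : nat) : \bar R := iter n exit_time q%:E.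

Arguments exits : simpl never.

(** A step that is never completed counts as down, so that an up step is always decided at a finite
    time. *)
Definition up_step (q : R) (n : nat) : bool :=
  (exits q n.+1 < +oo)%E && (f (fine (exits q n)) < f (fine (exits q n.+1))).

Lemma exit_time_ge tau : (tau <= exit_time tau)%E.
Proof. by apply: le_ereal_inf_tmp => _ [u [tu _] <-]. Qed.

Lemma exits_le q n : (exits q n <= exits q n.+1)%E.
Proof. exact: exit_time_ge. Qed.

Lemma exits0 q : exits q 0 = q%:E.
Proof. by []. Qed.

Lemma exitsS q n : exits q n.+1 = exit_time (exits q n).
Proof. by []. Qed.

Lemma exits_homo q m n : (m <= n)%N -> (exits q m <= exits q n)%E.
Proof.
move=> /subnKC <-; elim: (n - m)%N => [|k IHk]; first by rewrite addn0.
by rewrite addnS (le_trans IHk)// exits_le.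
Qed.

Lemma exits_ge q n : (q%:E <= exits q n)%E.
Proof. exact: (exits_homo q (leq0n n)). Qed.

Hypotheses (eps0 : 0 < eps) (cf : continuous f).

Let gap s v := `|f v - f s|.

Let cgap s : continuous (gap s).
Proof. by move=> v; apply: cvg_norm; apply: cvgB; [exact: cf|exact: cvg_cst]. Qed.

(** If the gap differed from [eps] at the infimum, it would by continuity differ from [eps] nearby,
    and the infimum would be larger. *)
Lemma exit_time_attained s u : exit_time s%:E = u%:E ->
  s <= u /\ `|f u - f s| = eps.
Proof.
move=> su; split; first by rewrite -lee_fin -su exit_time_ge.
apply/eqP/negP => /negP; rewrite -subr_eq0 => gu.
have : \forall v \near u, gap s v - eps != 0.
  have h : (fun v => gap s v - eps) v @[v --> u] --> gap s u - eps.
    by apply: cvgB; [exact: cgap|exact: cvg_cst].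
  exact: cvgr_neq0 h gu.
move=> /nbhs_ballP[e /= e0 ue].
have : ((u + e)%:E <= exit_time s%:E)%E.
  apply: le_ereal_inf_tmp => _ [v [sv gv] <-]; rewrite lee_fin leNgt; apply/negP => vue.
  have uv : u <= v by rewrite -lee_fin -su; apply: ereal_inf_lbound; exists v.
  have /ue : ball u e v by rewrite /ball/= distrC ger0_norm; lra.
  by rewrite /gap gv subrr eqxx.
by rewrite su lee_fin; lra.
Qed.

Lemma exit_time_leP s t : (exit_time s%:E <= t%:E)%E <->
  exists2 u, s <= u <= t & eps <= `|f u - f s|.
Proof.
split=> [st|[u /andP[su ut] gu]].
  have [s' [sE ss']] : exists s', exit_time s%:E = s'%:E /\ s <= s'.
    have := exit_time_ge s%:E.
    case: (exit_time s%:E) st => [r| |]//.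
    by rewrite !lee_fin => rt sr; exists r.
  have [_ gE] := exit_time_attained sE.
  by exists s'; rewrite ?gE// ss' -lee_fin -sE.
have [| |v] := @IVT R (gap s) s u eps su.
- by apply: continuous_subspaceT => v; exact: cgap.
- by rewrite /gap subrr normr0 ge_min ltW//= le_max gu orbT.
rewrite in_itv /= => /andP[sv vu] gv; apply: (@le_trans _ _ v%:E).
  by apply: ereal_inf_lbound; exists v.
by rewrite lee_fin; lra.
Qed.

Lemma before_exit_time s v : s <= v -> (v%:E < exit_time s%:E)%E ->
  `|f v - f s| < eps.
Proof.
move=> sv vs; rewrite ltNge; apply/negP => gv; move: vs; rewrite ltNge => /negP; apply.
by apply/exit_time_leP; exists v; rewrite ?sv ?lexx.
Qed.

Lemma exits_EFin q n : (exits q n < +oo)%E ->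
  exits q n = (fine (exits q n))%:E.
Proof. by have := exits_ge q n; case: exits. Qed.

Lemma exits_step q n : (exits q n.+1 < +oo)%E ->
  `|f (fine (exits q n.+1)) - f (fine (exits q n))| = eps.
Proof.
move=> h; have h' := le_lt_trans (exits_le q n) h.
have := exits_EFin h; rewrite [in LHS]exitsS.
by rewrite {1}(exits_EFin h') => /exit_time_attained[].
Qed.

Lemma exits_before q n v : (exits q n <= v%:E)%E -> (v%:E < exits q n.+1)%E ->
  `|f v - f (fine (exits q n))| < eps.
Proof.
move=> nv vn; have h := exits_EFin (le_lt_trans nv (ltry v)).
apply: before_exit_time; first by rewrite -lee_fin -h.
by rewrite -h.
Qed.

Lemma up_stepE q n : (exits q n.+1 < +oo)%E ->
  f (fine (exits q n.+1)) - f (fine (exits q n)) =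
  (if up_step q n then 1 else -1) * eps.
Proof.
move=> h; have := exits_step h; rewrite /up_step h /=.
by case: ltP => fn; [rewrite ger0_norm|rewrite ler0_norm]; lra.
Qed.

Lemma exits_walk q n : (exits q n < +oo)%E ->
  f (fine (exits q n)) = f q + (walk (up_step q) n)%:~R * eps.
Proof.
elim: n => [|n IHn] h; first by rewrite exits0 /= mul0r addr0.
have -> : f (fine (exits q n.+1)) = f (fine (exits q n)) +
  (f (fine (exits q n.+1)) - f (fine (exits q n))) by ring.
rewrite up_stepE// IHn ?(le_lt_trans (exits_le q n))//= rmorphD /=.
by case: ifP => _; rewrite ?rmorphN /=; ring.
Qed.

(** Bounded exit times would increase to a finite limit, where continuity makes the increments of
    [f] tend to 0, although each has size [eps]. *)
Lemma exits_exceed q t : exists n, (t%:E < exits q n)%E.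
Proof.
apply: contrapT => h; have {}h n : (exits q n <= t%:E)%E.
  by rewrite leNgt; apply/negP => tn; apply: h; exists n.
have fin n := exits_EFin (le_lt_trans (h n) (ltry t)).
pose x n := fine (exits q n).
have xcvg : cvgn x.
  apply: nondecreasing_is_cvgn.
    by apply/nondecreasing_seqP => n; rewrite -lee_fin -!fin exits_le.
  by exists t => _ [n _ <-]; rewrite -lee_fin -fin.
have fx : f \o x @ \oo --> f (limn x) by apply: continuous_cvg => //; exact: cf.
have : (fun n => `|f (x n.+1) - f (x n)|) @ \oo --> `|f (limn x) - f (limn x)|.
  apply: cvg_norm; apply: cvgB => //.
  by rewrite (cvg_shiftS (f \o x)).
have -> : (fun n => `|f (x n.+1) - f (x n)|) = cst eps.
  by apply/funext => n; apply: exits_step; rewrite fin ltry.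
rewrite subrr normr0 => /cvg_lim; rewrite lim_cst// => /(_ (@Rhausdorff R)) e.
by move: eps0; rewrite e ltxx.
Qed.

Lemma exits_cvgy q : exits q n @[n --> \oo] --> +oo%E.
Proof.
apply/cvgeyPgt => t; have [n tn] := exits_exceed q t.
by exists n => // m /= nm; rewrite (lt_le_trans tn)// exits_homo.
Qed.

Lemma exits_bracket q t : q <= t ->
  exists n, (exits q n <= t%:E)%E /\ (t%:E < exits q n.+1)%E.
Proof.
move=> qt; have ex := exits_exceed q t; case: (ex_minnP ex) => -[|n] tn min.
  by move: tn; rewrite exits0 lte_fin; lra.
by exists n; split => //; rewrite leNgt; apply/negP => /min; rewrite ltnn.
Qed.

Lemma increase_wins (q t v : R) (N B : nat) : (0 < N)%N -> q <= t -> t <= v ->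
  (forall s, q <= s <= t -> f s <= f t) -> (forall u, t < u <= v -> f t < f u) ->
  f t <= f q + (B * N)%:R * eps -> f t + N%:R * eps <= f v ->
  exists2 n, (exits q n <= v%:E)%E &
    climb (play N (B * N + N) (up_step q) n) = N.
Proof.
move=> N0 qt tv below above ft fv.
(* The walk is read at its last samples up to [t] and up to [v], whose values are within [eps] of
   [f t] and [f v]. *)
have [m [mt tm]] := exits_bracket qt.
have [n [nv vn]] := exits_bracket (le_trans qt tv).
exists n => //; have mn : (m <= n)%N.
  rewrite leqNgt; apply/negP => nm.
  by have := lt_le_trans vn (le_trans (exits_homo q nm) mt); rewrite lte_fin; lra.
have fin_le k s : (exits q k <= s%:E)%E -> (exits q k < +oo)%E.
  by move=> h; exact: le_lt_trans h (ltry s).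
have fE k s : (exits q k <= s%:E)%E ->
    f (fine (exits q k)) = f q + (walk (up_step q) k)%:~R * eps.
  by move=> /fin_le; exact: exits_walk.
have mE := fE m t mt; have nE := fE n v nv.
have := exits_before mt tm; have := exits_before nv vn.
rewrite !ltr_norml => /andP[_ vw] /andP[_ tw].
have mle : f (fine (exits q m)) <= f t.
  by apply: below; rewrite -!lee_fin -exits_EFin ?exits_ge ?mt//; exact: fin_le mt.
(* Sampled values lie on a lattice of mesh [eps], so a comparison with an error below [eps] gives an
   exact comparison of walk levels. *)
have leW (i j : int) : i%:~R * eps < j%:~R * eps + eps -> i <= j.
  have -> : j%:~R * eps + eps = (j + 1)%:~R * eps by rewrite intrD; ring.
  by rewrite ltr_pM2r// ltr_int ltzD1.
apply: (increase_won (m := m) (n := n)) => //.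
- move=> k km; have kt := le_trans (exits_homo q km) mt; apply: leW.
  have := fE _ _ kt; have : f (fine (exits q k)) <= f t.
    by apply: below; rewrite -!lee_fin -exits_EFin ?exits_ge ?kt//; exact: fin_le kt.
  lra.
- move=> k /andP[mk kn]; have kv := le_trans (exits_homo q kn) nv; apply: leW.
  have [<-|km] := eqVneq m k; first lra.
  have := fE _ _ kv; have : f t < f (fine (exits q k)).
    apply: above; rewrite -lte_fin -lee_fin -exits_EFin ?kv ?andbT; last exact: fin_le kv.
    by rewrite (lt_le_trans tm)// exits_homo// ltn_neqAle km.
  lra.
- apply: leW; rewrite intrD; lra.
- by apply: leW; rewrite !intrD /=; lra.
Qed.

End exits.

Arguments exits : simpl never.

(** * Measurability of stopped paths *)

Section evaluation.
Context d (T : measurableType d) (R : realType).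

Lemma measurable_fun_comparable (f g : T -> R) :
  measurable_fun setT f -> measurable_fun setT g ->
  measurable [set x | f x < g x].
Proof.
move=> mf mg; have := measurable_funB mg mf measurableT (measurable_itv `]0 : R, +oo[).
rewrite setTI; congr measurable; apply/seteqP; split => x /=;
  by rewrite in_itv /= andbT subr_gt0.
Qed.

Lemma measurable_fun_eval (Y : R -> T -> R) (tau : T -> R) :
  (forall s, measurable_fun setT (Y s)) -> (forall x, continuous (Y^~ x)) ->
  measurable_fun setT tau -> measurable_fun setT (fun x => Y (tau x) x).
Proof.
move=> mY cY mtau mD; apply: (measurability _ (RGenOInfty.measurableE R)) => //.
move=> _ [_ [c ->] <-]; rewrite setTI preimage_itvoy.
pose e (n : nat) : R := n.+1%:R^-1.
have e0 n : 0 < e n by rewrite invr_gt0.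
(* By continuity, Y (tau x) x > c iff for some n and some rational a within e n of
   tau x, all rational s within e n of a satisfy Y s x >= c + e n. *)
rewrite [X in measurable X](_ : _ = \bigcup_n \bigcup_(a : rat)
  ([set x | ratr a - e n < tau x] `&` [set x | tau x < ratr a + e n] `&`
   ~` (\bigcup_(s in [set s : rat | `|ratr s - ratr a| < e n])
         [set x | Y (ratr s) x < c + e n]))).
  apply: bigcupT_measurable => n; apply: bigcupT_measurable_rat => a.
  apply: measurableI; first apply: measurableI.
  - exact: measurable_fun_comparable.
  - exact: measurable_fun_comparable.
  - apply: measurableC; rewrite bigcup_mkcond; apply: bigcupT_measurable_rat => s.
    by case: ifP => // _; exact: measurable_fun_comparable.
apply/seteqP; split => [x /= cx|x [n _ [a _ [[/= ax xa] Yx]]] /=].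
  have c3 : 0 < (Y (tau x) x - c) / 2 by rewrite divr_gt0// subr_gt0.
  have /cvgrPdist_lt/(_ _ c3)/nbhs_ballP[r /= r0 xr] := cY x (tau x).
  have [n nr nY] : exists2 n, e n < r / 2 & e n < (Y (tau x) x - c) / 2.
    have m0 : 0 < Num.min (r / 2) ((Y (tau x) x - c) / 2).
      by rewrite lt_min c3 divr_gt0.
    have [n _ /(_ n (leqnn n))] := @near_infty_natSinv_lt R (PosNum m0).
    by rewrite /= lt_min => /andP[? ?]; exists n.
  exists n => //; have [a] : exists a : rat, ratr a \in `]tau x - e n, tau x + e n[.
    by apply: rat_in_itvoo; have := e0 n; lra.
  rewrite in_itv /= => /andP[xa ax]; exists a => //; split; first by split => /=; lra.
  move=> [s /= sa]; have : `|Y (tau x) x - Y (ratr s) x| < (Y (tau x) x - c) / 2.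
    by apply: xr; rewrite /ball /=; move: sa; rewrite !ltr_norml => /andP[? ?]; lra.
  by rewrite ltr_norml => /andP[? ?]; lra.
rewrite ltNge; apply/negP => Yc.
have /cvgrPdist_lt/(_ _ (e0 n))/nbhs_ballP[r /= r0 xr] := cY x (tau x).
have [s] : exists s : rat, ratr s \in
    `]Num.max (tau x - r) (ratr a - e n), Num.min (tau x + r) (ratr a + e n)[.
  by apply: rat_in_itvoo; rewrite gt_max !lt_min; have := e0 n; lra.
rewrite in_itv /= gt_max lt_min => /andP[/andP[s1 s2] /andP[s3 s4]].
apply: Yx; exists s => /=; first by rewrite ltr_norml; lra.
have : `|Y (tau x) x - Y (ratr s) x| < e n.
  by apply: xr; rewrite /ball/= ltr_norml; lra.
by rewrite ltr_norml => /andP[? ?]; lra.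
Qed.

End evaluation.

(** * The filtration of the path space and stopped values *)

Section filtration.
Variable R : realType.

Definition zero_path : path_space R := cst 0.

HB.instance Definition _ := Choice.on (path_space R).
HB.instance Definition _ := isPointed.Build (path_space R) zero_path.

Lemma val_insubd_time0 (t : R) : val (insubd (time0 R) t) = Num.max t 0.
Proof.
have v0 : val (time0 R) = 0 by [].
by rewrite val_insubd v0 mem_setE in_itv /= andbT; case: leP.
Qed.

Lemma at_time_continuous (w : path_space R) : continuous (at_time w).
Proof.
pose proj (t : R) : set_type `[0 : R, +oo[%classic := insubd (time0 R) t.
suff cproj : continuous proj.
  by move=> t; apply: (@continuous_comp _ _ _ proj w); [exact: cproj|exact: cts_fun].
apply: continuous_comp_initial => t.
have -> : set_val \o proj = (fun t : R => Num.max t 0).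
  apply/funext => s; transitivity (val (proj s)) => //.
  exact: val_insubd_time0.
by apply: continuous_max; [exact: cvg_id|exact: cvg_cst].
Qed.

Definition upto (t : R) : measurableType _ := g_sigma_algebraType (\bigcup_(s in `[0, t])
  preimage_set_system setT (fun w : path_space R => at_time w s)
    (measurable : set (set R))).

(** Capping the instant at [t] gives a value observed by time [t] for every real [s], as
    [measurable_fun_eval] requires. *)
Lemma measurable_at_time (t s : R) : 0 <= t ->
  measurable_fun setT ((fun w => at_time w (Num.min s t)) : upto t -> R).
Proof.
move=> t0; have -> : (fun w : path_space R => at_time w (Num.min s t)) =
    (fun w => at_time w (Num.max 0 (Num.min s t))).
  apply/funext => w; rewrite /at_time; congr (w _).
  apply: val_inj; rewrite !val_insubd_time0 [in RHS]maxC maxA maxxx.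
  by rewrite maxC.
move=> _ B mB; apply: sub_sigma_algebra; exists (Num.max 0 (Num.min s t)).
  by rewrite /= in_itv /= le_max lexx /= ge_max t0 ge_min lexx orbT.
by exists B.
Qed.

Lemma sigma_upto_sub (s t : R) : s <= t -> @sigma_upto R s `<=` @sigma_upto R t.
Proof.
move=> st; apply: sub_sigma_algebra2; apply: bigcup_subset => r /=.
by rewrite !in_itv /= => /andP[-> rs]; exact: le_trans rs st.
Qed.

Lemma sigma_upto_sub_infty (t : R) : 0 <= t -> @sigma_upto R t `<=` @sigma_infty R.
Proof.
by move=> t0 A At; apply: sub_sigma_algebra; exists t => //=; rewrite in_itv /= t0.
Qed.

(** Only levels [c] in [[0, t[] give a nontrivial event, the complement of [tau <= c], which is
    known already at time [c]. *)
Lemma measurable_stop (tau : path_space R -> \bar R) (t : R) : 0 <= t ->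
  is_stopping_time tau ->
  measurable_fun setT ((fun w => fine (Order.min (tau w) t%:E)) : upto t -> R).
Proof.
move=> t0 [tau0 tauF] mD; apply: (measurability _ (RGenOInfty.measurableE R)) => //.
move=> _ [_ [c ->] <-]; rewrite setTI preimage_itvoy.
have finE w : (fine (Order.min (tau w) t%:E))%:E = Order.min (tau w) t%:E.
  by have := tau0 w; case: (tau w) => [r||]//= r0; case: leP.
have [c0|c0] := ltP c 0.
  rewrite [X in measurable X](_ : _ = setT)//; apply/seteqP; split => w //= _.
  by rewrite -lte_fin finE lt_min (lt_le_trans _ (tau0 w)) ?lte_fin// (lt_le_trans c0).
have [ct|tc] := ltP c t; last first.
  rewrite [X in measurable X](_ : _ = set0)//; apply/seteqP; split => w //=.
  by rewrite -lte_fin finE lt_min [X in _ && X]lte_fin [X in _ && X]ltNge tc andbF.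
rewrite [X in measurable X](_ : _ = ~` [set w | (tau w <= c%:E)%E]).
  apply: measurableC; apply: (sigma_upto_sub (ltW ct)); exact: tauF.
apply/seteqP; split => w /=; rewrite -lte_fin finE lt_min [X in _ && X]lte_fin ct andbT ltNge.
  by move/negP.
by move=> h; apply/negP.
Qed.

Lemma fine_min_le (x : \bar R) (t : R) : (0 <= x)%E -> fine (Order.min x t%:E) <= t.
Proof.
by case: x => [r| |] //= _; rewrite -EFin_min /= ge_min lexx orbT.
Qed.

Lemma measurable_random_value (t : R) (T : upto t -> R) : 0 <= t ->
  measurable_fun setT T -> (forall w, T w <= t) ->
  measurable_fun setT (fun w : upto t => at_time w (T w)).
Proof.
move=> t0 mT Tt; pose Y s (w : upto t) := at_time w (Num.min s t).
have cY w : continuous (Y^~ w).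
  move=> s; apply: (@continuous_comp _ _ _ (fun s => Num.min s t) (at_time w)).
    by apply: continuous_min; [exact: cvg_id|exact: cvg_cst].
  exact: at_time_continuous.
have := measurable_fun_eval (fun s => measurable_at_time s t0) cY mT.
by congr measurable_fun; apply/funext => w; congr at_time; exact/min_idPl.
Qed.

Lemma measurable_stopped_value (tau : path_space R -> \bar R) (t : R) : 0 <= t ->
  is_stopping_time tau ->
  measurable_fun setT
    ((fun w => at_time w (fine (Order.min (tau w) t%:E))) : upto t -> R).
Proof.
move=> t0 st; apply: measurable_random_value => //; first exact: measurable_stop.
by move=> w; apply: fine_min_le; exact: st.1.
Qed.

End filtration.

(** * The exit strategy *)

Section stopped_events.
Variable R : realType.
Implicit Types (tau : path_space R -> \bar R) (A B : set (path_space R)).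

Lemma sigma_upto_measurable (t : R) (A : set (path_space R)) :
  measurable (A : set (upto t)) -> sigma_upto t A.
Proof. by []. Qed.

Lemma sigma_stopped_finite tau A : (forall w, A w -> (tau w < +oo)%E) ->
  (forall t : R, 0 <= t -> sigma_upto t (A `&` [set w | (tau w <= t%:E)%E])) ->
  sigma_stopped tau A.
Proof.
move=> Afin At; split => //.
rewrite (_ : A = \bigcup_(n : nat) (A `&` [set w | (tau w <= n%:R%:E)%E])).
  apply: sigma_algebra_bigcup => n.
  by apply: (@sigma_upto_sub_infty _ n%:R) => //; exact: At.
apply/seteqP; split => [w Aw|w [n _ []]//].
have := Afin w Aw; case E : (tau w) => [r| |]// _.
  exists (Num.truncn `|r|).+1 => //; split => //=; rewrite E lee_fin.
  by rewrite (le_trans (ler_norm r))// ltW// Num.Theory.truncnS_gt.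
by exists 0%N => //; split => //=; rewrite E leNye.
Qed.

Lemma sigma_stoppedC tau A : is_stopping_time tau ->
  sigma_stopped tau A -> sigma_stopped tau (~` A).
Proof.
move=> [_ st] [Ainf At]; split; first exact: sigma_algebraC.
move=> t t0; rewrite (_ : _ `&` _ = [set w | (tau w <= t%:E)%E] `\`
    (A `&` [set w | (tau w <= t%:E)%E])).
  apply: sigma_upto_measurable; apply: measurableD; [exact: st|exact: At].
by apply/seteqP; split => w /=; tauto.
Qed.

Lemma sigma_stoppedU tau A B :
  sigma_stopped tau A -> sigma_stopped tau B -> sigma_stopped tau (A `|` B).
Proof.
move=> [Ai At] [Bi Bt]; split; first exact: (@measurableU _ (g_sigma_algebraType _)).
by move=> t t0; rewrite setIUl; apply: sigma_upto_measurable; apply: measurableU;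
  [exact: At|exact: Bt].
Qed.

Lemma sigma_stoppedI tau A B : is_stopping_time tau ->
  sigma_stopped tau A -> sigma_stopped tau B -> sigma_stopped tau (A `&` B).
Proof.
move=> st As Bs; rewrite -[A `&` B]setCK setCI; apply: sigma_stoppedC => //.
by apply: sigma_stoppedU; exact: sigma_stoppedC.
Qed.

Lemma sigma_stopped_sub tau tau' : is_stopping_time tau' ->
  (forall w, (tau w <= tau' w)%E) -> sigma_stopped tau `<=` sigma_stopped tau'.
Proof.
move=> [_ st] tt' A [Ai At]; split => // t t0.
rewrite (_ : _ `&` _ = (A `&` [set w | (tau w <= t%:E)%E]) `&`
    [set w | (tau' w <= t%:E)%E]).
  apply: sigma_upto_measurable; apply: measurableI; [exact: At|exact: st].
apply/seteqP; split => w /= [Aw wt]; last by split => //; case: Aw.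
by split => //; split => //; exact: le_trans (tt' w) wt.
Qed.

Lemma sigma_stopped_const tau (P : Prop) : is_stopping_time tau ->
  sigma_stopped tau [set _ | P].
Proof.
move=> st; have [p|p] := pselect P.
  rewrite (_ : mkset _ = ~` set0); last by apply/seteqP; split => w //= _ [].
  apply: sigma_stoppedC => //; split; first exact: sigma_algebra0.
  by move=> t t0; rewrite set0I; exact: sigma_algebra0.
rewrite (_ : mkset _ = set0); last by apply/seteqP; split => w.
split; first exact: sigma_algebra0.
by move=> t t0; rewrite set0I; exact: sigma_algebra0.
Qed.

End stopped_events.

(** * The game played at the exit times of a path *)

Section exit_strategy.
Variables (R : realType) (sg q eps : R).
Hypotheses (sg1 : `|sg| = 1) (q0 : 0 <= q) (eps0 : 0 < eps).

Definition signed_path (w : path_space R) (t : R) : R := sg * at_time w t.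

Lemma signed_path_continuous w : continuous (signed_path w).
Proof. by move=> t; apply: cvgZr; exact: at_time_continuous. Qed.

Let cf := signed_path_continuous.

Let tau n w : \bar R := exits eps (signed_path w) q n.

Lemma exits_stopping_time n : is_stopping_time (tau n).
Proof.
split=> [w|].
  by rewrite (le_trans _ (exits_ge _ _ _ n))// lee_fin.
elim: n => [|n IHn] t t0.
  have [qt|tq] := leP q t.
    rewrite (_ : mkset _ = setT); last by apply/seteqP; split => w.
    exact: (@measurableT _ (upto t)).
  rewrite (_ : mkset _ = set0); first exact: sigma_algebra0.
  by apply/seteqP; split => w //=; rewrite lee_fin leNgt tq.
have st : is_stopping_time (tau n).
  by split => // w; rewrite (le_trans _ (exits_ge _ _ _ n))// lee_fin.
pose T w := fine (Order.min (tau n w) t%:E).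
pose clip (r : rat) w := Num.max (T w) (Num.min (ratr r) t).
have mT : measurable_fun setT (T : upto t -> R) by exact: measurable_stop.
have mclip r : measurable_fun setT (clip r : upto t -> R).
  by apply: measurable_maxr => //; exact: measurable_cst.
have clip_le r w : clip r w <= t.
  by rewrite /clip ge_max ge_min lexx orbT andbT fine_min_le//; exact: st.1.
have mfclip r : measurable_fun setT ((fun w => at_time w (clip r w)) : upto t -> R).
  exact: measurable_random_value.
(* By continuity and the extreme value theorem, the path leaves the interval by
   time t iff its distance to the starting value gets arbitrarily close to eps at
   rational times; clipping them to [T w, t] loses none of the values. *)
rewrite (_ : mkset _ = [set w | (tau n w <= t%:E)%E] `&`
   \bigcap_(k : nat) \bigcup_(r : rat)
     [set w | eps - k.+1%:R^-1 < `|at_time w (clip r w) - at_time w (T w)|]).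
  apply: sigma_upto_measurable; apply: measurableI; first exact: IHn.
  apply: bigcapT_measurable => k; apply: bigcupT_measurable_rat => r.
  apply: measurable_fun_comparable; first exact: measurable_cst.
  apply: measurableT_comp; first exact: normr_measurable.
  by apply: measurable_funB => //; exact: measurable_stopped_value.
have gapE w u s : `|at_time w u - at_time w s| = `|signed_path w u - signed_path w s|.
  by rewrite /signed_path -mulrBr normrM sg1 mul1r.
apply/seteqP; split => [w /= wt|w [/= wt kr]].
  have nt : (tau n w <= t%:E)%E by rewrite (le_trans _ wt)// exits_le.
  have tauE : tau n w = (T w)%:E.
    by rewrite /T (min_idPl nt) -exits_EFin// (le_lt_trans nt)// ltry.
  split => //; move: wt; rewrite /tau exitsS -/(tau n w) tauE.
  move=> /(exit_time_leP eps0 (cf (w:=w)))[u /andP[Tu ut] gu] k _.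
  have k0 : 0 < k.+1%:R^-1 :> R by rewrite invr_gt0.
  have /cvgrPdist_lt/(_ _ k0)/nbhs_ballP[d /= d0 ud] :=
    @at_time_continuous R w u.
  have [r] : exists r : rat, ratr r \in `]u - d, u + d[ by apply: rat_in_itvoo; lra.
  rewrite in_itv /= => /andP[r1 r2]; exists r => //=.
  (* Clipping to [[T w, t]], which contains [u], does not increase the distance to [u]. *)
  have : `|at_time w u - at_time w (clip r w)| < k.+1%:R^-1.
    apply: ud; rewrite /ball /= ltr_norml /clip.
    by case: (leP (ratr r) t) => rt; case: (leP (T w) _) => Tr; lra.
  have := ler_distD (at_time w (clip r w)) (at_time w u) (at_time w (T w)).
  by move: gu; rewrite -gapE; move: (_.+1%:R^-1) => e; lra.
have tauE : tau n w = (T w)%:E.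
  by rewrite /T (min_idPl wt) -exits_EFin// (le_lt_trans wt)// ltry.
rewrite /tau exitsS -/(tau n w) tauE.
apply/(exit_time_leP eps0 (cf (w:=w))).
have Tt : T w <= t by rewrite -lee_fin -tauE.
have [|c] := @EVT_max R (fun u => `|at_time w u - at_time w (T w)|) _ _ Tt.
  apply: continuous_subspaceT => v; apply: cvg_norm; apply: cvgB; last exact: cvg_cst.
  exact: at_time_continuous.
rewrite in_itv /= => /andP[Tc ct] cmax; exists c; first by rewrite Tc.
rewrite -gapE; apply/ler_addgt0Pl => e e0.
have [k _ /(_ k (leqnn k)) ke] := @near_infty_natSinv_lt R (PosNum e0).
have [r _ /= rk] := kr k I.
have : `|at_time w (clip r w) - at_time w (T w)| <= `|at_time w c - at_time w (T w)|.
  by apply: cmax; rewrite in_itv /= clip_le andbT /clip le_max lexx.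
by move: ke rk => /=; move: (_.+1%:R^-1) => e'; lra.
Qed.

Lemma up_step_stopped n :
  sigma_stopped (tau n.+1) [set w | up_step eps (signed_path w) q n].
Proof.
apply: sigma_stopped_finite => [w /= /andP[]//|t t0].
have stop_at m w : (tau m w <= t%:E)%E -> fine (tau m w) = fine (Order.min (tau m w) t%:E).
  by move=> /min_idPl ->.
rewrite (_ : _ `&` _ = [set w | (tau n.+1 w <= t%:E)%E] `&`
  [set w | sg * at_time w (fine (Order.min (tau n w) t%:E)) <
           sg * at_time w (fine (Order.min (tau n.+1 w) t%:E))]).
  apply: sigma_upto_measurable; apply: measurableI.
    exact: (exits_stopping_time n.+1).2.
  by apply: measurable_fun_comparable;
    (apply: measurableT_comp; [exact: mulrl_measurable|
     exact: measurable_stopped_value (exits_stopping_time _)]).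
have steps w : (tau n.+1 w <= t%:E)%E -> up_step eps (signed_path w) q n =
    (sg * at_time w (fine (Order.min (tau n w) t%:E)) <
     sg * at_time w (fine (Order.min (tau n.+1 w) t%:E))).
  move=> wt; rewrite -!stop_at//; last by rewrite (le_trans _ wt)// exits_le.
  by rewrite /up_step (le_lt_trans wt (ltry _)).
by apply/seteqP; split => w /= [] => [+ wt|wt +]; rewrite steps.
Qed.

Variables (N K : nat) (alpha : R).
Hypotheses (N0 : (0 < N)%N) (alpha0 : 0 <= alpha).

Let pos w n := play N K (up_step eps (signed_path w) q) n.

(** The new position is determined by the old one, known at [tau n], and the last step, known at
    [tau n.+1]. Allowing every set [A] makes every real function of the position measurable. *)
Lemma play_stopped n (A : set position) :
  sigma_stopped (tau n) [set w | A (pos w n)].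
Proof.
elim: n A => [|n IHn] A.
  exact: (@sigma_stopped_const R _ (A (Position 0 0 0)) (exits_stopping_time 0)).
have stn := exits_stopping_time n.+1.
have up := up_step_stopped n.
have old B : sigma_stopped (tau n.+1) [set w | B (pos w n)].
  by apply: (sigma_stopped_sub stn) (IHn B) => w; exact: exits_le.
rewrite (_ : mkset _ =
  ([set w | (A \o (advance N K)^~ true) (pos w n)] `&`
     [set w | up_step eps (signed_path w) q n]) `|`
  ([set w | (A \o (advance N K)^~ false) (pos w n)] `&`
     ~` [set w | up_step eps (signed_path w) q n])).
  apply: sigma_stoppedU; apply: sigma_stoppedI => //.
  exact: sigma_stoppedC.
apply/seteqP; split => w /=; rewrite /pos /= -/(pos w n).
  by case: up_step => h; [left|right; split].
by move=> [[h ->]//|[h /negP/negPf->]].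
Qed.

(** The factor [sg / eps] makes each completed step of the signed path pay plus or minus
    [alpha * stake]. *)
Definition exit_bet n w : R := sg * (alpha / eps) * stake R N K (pos w n).

Lemma exit_bet_bounded n : exists M : R, forall w, `|exit_bet n w| <= M.
Proof.
exists (alpha / eps * slope R N) => w.
rewrite /exit_bet !normrM sg1 mul1r.
rewrite (ger0_norm (stake_ge0 _ _ _ _)) -normrM (@ger0_norm _ (alpha / eps)).
  by rewrite ler_wpM2l ?stake_le// divr_ge0// ltW.
by rewrite divr_ge0// ltW.
Qed.

Lemma exit_bet_measurable n (B : set R) : measurable B ->
  sigma_stopped (tau n) (exit_bet n @^-1` B).
Proof.
move=> _; exact: (play_stopped n [set s | B (sg * (alpha / eps) * stake R N K s)]).
Qed.

Definition exit_strategy : strategy R :=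
  @Strategy R tau exit_bet exits_stopping_time
    (fun n w => exits_le eps (signed_path w) q n)
    (fun w => exits_cvgy eps0 (cf (w:=w)) q)
    exit_bet_bounded exit_bet_measurable.

(** * The capital of the exit strategy at a fixed time *)

Section capital.
Variables (w : path_space R) (t : R).
Hypothesis t0 : 0 <= t.

Let f := signed_path w.
Let time n : R := fine (Order.min (tau n w) t%:E).
Let gain n : R := alpha / eps * stake R N K (pos w n) * (f (time n.+1) - f (time n)).
Let partial n : R := alpha * K%:R + \sum_(k < n) gain k.

Lemma exit_capital_partial m : (t%:E < tau m w)%E ->
  elementary_capital exit_strategy (alpha * K%:R) t w = partial m.
Proof.
move=> tm; rewrite /elementary_capital /partial; congr (_ + _).
have gainE : (fun n => bet exit_strategy n w *
    (at_time w (fine (Order.min (stop exit_strategy n.+1 w) t%:E)) -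
     at_time w (fine (Order.min (stop exit_strategy n w) t%:E)))) = gain.
  by apply/funext => n; rewrite /= /exit_bet /gain /f /signed_path -mulrBr; ring.
rewrite gainE; apply: (@norm_lim_near_cst _ R^o).
exists m => // n /= mn; rewrite /series /= big_mkord.
rewrite -(subnKC mn) big_split_ord /= [X in _ + X]big1 ?addr0// => k _.
have late j : (m <= j)%N -> time j = t.
  move=> mj; rewrite /time (min_idPr _)// ltW// (lt_le_trans tm)//.
  exact: exits_homo.
by rewrite /gain !late ?subrr ?mulr0//; lia.
Qed.

(** Both sides start at [alpha * K], and each completed step changes both by plus or minus
    [alpha * stake]. *)
Lemma partial_reached n : (tau n w <= t%:E)%E ->
  partial n = alpha * worth R K (pos w n).
Proof.
elim: n => [|n IHn] nt.
  by rewrite /partial big_ord0 /worth /= slope0; ring.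
have nt' : (tau n w <= t%:E)%E by rewrite (le_trans _ nt)// exits_le.
rewrite /partial big_ord_recr /= addrA -/(partial n) IHn//.
rewrite worth_advance; last exact: coherent_play.
rewrite /gain /time (min_idPl nt) (min_idPl nt').
rewrite up_stepE//; last 1 first.
- exact: le_lt_trans nt (ltry _).
by have := eps0; rewrite lt0r => /andP[e0 _]; field.
Qed.

(** In an unfinished step the path has moved by less than [eps], so at most [alpha * stake] is lost,
    and [stake_le_worth] covers this loss. *)
Lemma partial_ge0 n : 0 <= partial n.
Proof.
elim: n => [|n IHn]; first by rewrite /partial big_ord0 addr0 mulr_ge0.
have coh k : coherent N K (pos w k) by exact: coherent_play.
have [nt|tn] := leP (tau n.+1 w) t%:E.
  by rewrite partial_reached// mulr_ge0// (worth_ge0 _ (coh _)).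
have [nt|tn'] := leP (tau n w) t%:E; last first.
  rewrite /partial big_ord_recr /= addrA -/(partial n) /gain /time.
  by rewrite (min_idPr (ltW tn)) (min_idPr (ltW tn')) subrr mulr0 addr0.
rewrite /partial big_ord_recr /= addrA -/(partial n) partial_reached//.
rewrite /gain /time (min_idPr (ltW tn)) (min_idPl nt) /=.
have : - eps < f t - f (fine (tau n w)).
  by have := exits_before eps0 (cf (w:=w)) nt tn; rewrite ltr_norml => /andP[].
move: (f t - _) => x ex.
rewrite [X in _ + X](_ : _ = alpha * (stake R N K (pos w n) * (x / eps))); last by ring.
rewrite -mulrDr mulr_ge0//.
have xe : -1 <= x / eps by rewrite ler_pdivlMr// mulN1r ltW.
have := ler_wpM2l (stake_ge0 R N K (pos w n)) xe.
have := stake_le_worth R N0 (coh n); lra.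
Qed.

Lemma exit_capital_ge0 :
  0 <= elementary_capital exit_strategy (alpha * K%:R) t w.
Proof.
have [m tm] := exits_exceed eps0 (cf (w:=w)) q t.
by rewrite (exit_capital_partial tm) partial_ge0.
Qed.

(** After a success all stakes are 0, so the capital keeps the value it had at the winning exit. *)
Lemma exit_capital_won n : (tau n w <= t%:E)%E -> climb (pos w n) = N ->
  alpha * (slope R N * N.+1%:R) <= elementary_capital exit_strategy (alpha * K%:R) t w.
Proof.
move=> nt won; have [m tm] := exits_exceed eps0 (cf (w:=w)) q t.
have nm : (n <= m)%N.
  rewrite leqNgt; apply/negP => /ltnW/(exits_homo eps f q) mn.
  by have := le_lt_trans (le_trans mn nt) tm; rewrite ltxx.
rewrite (exit_capital_partial tm).
have -> : partial m = partial n.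
  rewrite /partial -(subnKC nm) big_split_ord /= [X in _ + (_ + X)]big1 ?addr0// => k _.
  have nk : (n <= n + k)%N by rewrite leq_addr.
  by rewrite /gain /pos (won_stays nk won) stake_won// mulr0 mul0r.
by rewrite partial_reached// ler_wpM2l// worth_won//; exact: coherent_play.
Qed.

End capital.

End exit_strategy.

(** * Countable cover *)

Section countable_cover.
Variable R : realType.

Definition rises (f : R -> R) (q a : R) (B : nat) : Prop :=
  exists t v, [/\ q <= t <= v, forall s, q <= s <= t -> f s <= f t,
    forall u, t < u <= v -> f t < f u, f t <= f q + B%:R * a & f t + a <= f v].

Lemma rises_strategy (sg q a delta : R) (B : nat) :
  `|sg| = 1 -> 0 <= q -> 0 < a -> 0 < delta ->
  exists G c, [/\ 0 <= c <= delta,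
    forall w t, 0 <= t -> 0 <= elementary_capital G c t w &
    forall w, rises (signed_path sg w) q a B ->
      exists T, forall t, T <= t -> 1 <= elementary_capital G c t w].
Proof.
move=> sg1 q0 a0 d0; have [N N0 slopeN] := slope_unbounded (B.+1%:R / delta).
have slope0 : 0 < slope R N by rewrite (le_lt_trans _ slopeN)// divr_ge0// ltW.
have NR : 0 < N%:R :> R by rewrite ltr0n.
have N1R : 0 < N.+1%:R :> R by rewrite ltr0n.
(* This [alpha] makes a success worth at least 1. The initial capital [alpha * K] is then at most
   [B.+1 / slope N], below [delta] by the choice of [N]. *)
pose K := (B * N + N)%N; pose alpha := (slope R N * N.+1%:R)^-1.
have alpha0 : 0 <= alpha by rewrite invr_ge0 mulr_ge0// ltW.
have eps0 : 0 < a / N%:R by rewrite divr_gt0.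
exists (exit_strategy sg1 q0 eps0 N K alpha0), (alpha * K%:R); split.
- rewrite mulr_ge0//= /alpha invfM -mulrA.
  rewrite mulrC ler_pdivrMr//; apply: (@le_trans _ _ B.+1%:R).
    rewrite mulrC ler_pdivrMr// -natrM ler_nat /K; lia.
  by move: slopeN; rewrite ltr_pdivrMr// mulrC => /ltW.
- by move=> w t t0; exact: exit_capital_ge0.
- move=> w [t [v [/andP[qt tv] below above ft fv]]].
  have aE k : (k * N)%:R * (a / N%:R) = k%:R * a.
    by rewrite natrM; field; rewrite gt_eqF.
  have [] := @increase_wins R _ _ eps0 (@signed_path_continuous R sg w) q t v N B N0 qt tv below above.
  + by rewrite aE.
  + by rewrite -[N in N%:R * _]mul1n aE mul1r.
  move=> n nv won; exists v => s vs.
  have ns : (exits (a / N%:R) (signed_path sg w) q n <= s%:E)%E.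
    by rewrite (le_trans nv)// lee_fin.
  have s0 : 0 <= s by lra.
  apply: le_trans (exit_capital_won sg1 q0 eps0 N0 alpha0 s0 ns won).
  by rewrite /alpha mulVf// mulf_neq0 ?gt_eqF.
Qed.

Lemma rises_locally (f : R -> R) (t d : R) : 0 <= t -> 0 < d ->
  (forall s, Num.max (t - d) 0 < s < t -> f s <= f t) ->
  (forall u, t < u < t + d -> f t < f u) ->
  exists (r : rat) (p B : nat), rises f `|ratr r| p.+1%:R^-1 B.
Proof.
move=> t0 d0 below above.
have [r [rt fr]] : exists r : rat, `|ratr r| <= t /\
    forall s, `|ratr r| <= s <= t -> f s <= f t.
  have [t0'|] := ltP 0 t; last first.
    move=> t0'; have -> : t = 0 by lra.
    exists 0; rewrite rmorph0 normr0 lexx; split => // s s0.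
    by have -> : s = 0 by lra.
  have [r] : exists r : rat, ratr r \in `]Num.max (t - d) 0, t[.
    by apply: rat_in_itvoo; rewrite gt_max t0' andbT; lra.
  rewrite in_itv /= => /andP[dr rt]; exists r.
  have r0 : 0 < ratr r :> R by rewrite (le_lt_trans _ dr)// le_max lexx orbT.
  rewrite gtr0_norm//; split; first exact: ltW.
  move=> s /andP[rs]; rewrite le_eqVlt => /orP[/eqP->//|st].
  by apply: below; rewrite st (lt_le_trans dr rs).
have fv : 0 < f (t + d / 2) - f t by rewrite subr_gt0 above//; lra.
(* The rise of [f] over half the window fixes the height [1/(p+1)]; [B] is then an integer above
   [f t - f q] measured in that unit. *)
have [p _ /(_ p (leqnn p)) /= pv] := @near_infty_natSinv_lt R (PosNum fv).
exists r, p, (Num.truncn ((f t - f `|ratr r|) * p.+1%:R)).+1.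
exists t, (t + d / 2); split => //.
- by rewrite rt; lra.
- by move=> u /andP[tu ud]; apply: above; lra.
- rewrite -lerBlDl ler_pdivlMr// ltW//; exact: truncnS_gt.
- by move: pv; move: (_^-1) => e; lra.
Qed.

Definition cover_index : Type := bool * rat * nat * nat.

Definition cover_sign (i : cover_index) : R := if i.1.1.1 then 1 else -1.

(** The absolute value lets every rational encode a nonnegative starting time. *)
Definition covers (i : cover_index) (w : path_space R) : Prop :=
  rises (signed_path (cover_sign i) w) `|ratr i.1.1.2| i.1.2.+1%:R^-1 i.2.

Lemma semi_strict_covered (w : path_space R) (t : R) : 0 <= t ->
  semi_strict_increase w t \/ semi_strict_decrease w t ->
  exists i, covers i w.
Proof.
move=> t0 [] [d d0 [below above]].
  have [||r [p [B h]]] := @rises_locally (signed_path 1 w) t d t0 d0.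
  - by move=> s /below; rewrite /signed_path !mul1r.
  - by move=> s /above; rewrite /signed_path !mul1r.
  by exists (true, r, p, B).
have [||r [p [B h]]] := @rises_locally (signed_path (-1) w) t d t0 d0.
- by move=> s /below; rewrite /signed_path !mulN1r lerN2.
- by move=> s /above; rewrite /signed_path !mulN1r ltrN2.
by exists (false, r, p, B).
Qed.

Lemma limf_einf_ge (F : R -> \bar R) (a : \bar R) (T : R) :
  (forall t, T <= t -> (a <= F t)%E) -> (a <= limf_einf F +oo%R)%E.
Proof.
move=> aF; rewrite limf_einfE.
apply: (@le_trans _ _ (ereal_inf (F @` [set t | T <= t]))).
  by apply: le_ereal_inf_tmp => _ [t Tt <-]; exact: aF.
apply: ereal_sup_ubound; exists [set t | T <= t] => //.
by apply: nbhs_pinfty_ge; rewrite num_real.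
Qed.

(** At time 0 all capped instants coincide, so each elementary capital equals its [c_n], which
    positivity makes nonnegative. *)
Lemma initial_capital_ge0 (S : positive_capital_process R) :
  0 <= initial_capital S.
Proof.
have c0 n : 0 <= capitals S n.
  have := @elementary_capital_ge0 R S n 0 (zero_path R) (lexx 0).
  have min0 k : Order.min (stop (strategies S n) k (zero_path R)) 0%:E = 0%:E.
    by apply/min_idPr; have [] := stop_is_stopping_time (strategies S n) k.
  rewrite /elementary_capital (_ : (fun k => _) = fun=> 0); last first.
    by apply/funext => k; rewrite !min0 subrr mulr0.
  rewrite (@norm_lim_near_cst _ R^o _ _ _ 0) ?addr0//.
  by apply: nearW => k; rewrite /series /= big1.
apply: limr_ge; first exact: capitals_summable.
by apply: nearW => n; rewrite /series /=; exact: sumr_ge0.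
Qed.

(** The strategies for all indices run side by side with budgets [delta / 2^(n+1)]. As every summand
    is nonnegative, the total dominates the one that wins on a given event. *)
Lemma covers_process (delta : R) : 0 < delta ->
  exists S : positive_capital_process R, initial_capital S <= delta /\
    forall i w, covers i w ->
      exists T, forall t, T <= t -> (1 <= capital S t w)%E.
Proof.
move=> d0.
pose idx n : cover_index := odflt (true, 0, 0%N, 0%N) (unpickle n).
pose D n : R := delta / (2 ^ (n + 1))%:R.
have D0 n : 0 < D n by rewrite divr_gt0// ltr0n expn_gt0.
pose ok n (p : strategy R * R) := [/\ 0 <= p.2 <= D n,
    forall w t, 0 <= t -> 0 <= elementary_capital p.1 p.2 t w &
    forall w, covers (idx n) w ->
      exists T, forall t, T <= t -> 1 <= elementary_capital p.1 p.2 t w].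
have ex n : exists p, ok n p.
  have sg1 : `|cover_sign (idx n)| = 1.
    by rewrite /cover_sign; case: ifP; rewrite ?normrN normr1.
  have p0 : 0 < (idx n).1.2.+1%:R^-1 :> R by rewrite invr_gt0.
  have [G [c ?]] := rises_strategy (idx n).2 sg1 (normr_ge0 (ratr (idx n).1.1.2)) p0 (D0 n).
  by exists (G, c).
have [F FP] := choice ex.
have cvgD : series D @ \oo --> delta.
  by have := @cvg_geometric_series_half R delta 0; rewrite expr0 divr1.
have c0 n : 0 <= (F n).2 by have [/andP[]] := FP n.
have cD n : (F n).2 <= D n by have [/andP[]] := FP n.
have csum : cvgn (series (fun n => (F n).2)).
  apply: (series_le_cvg c0 (fun n => ltW (D0 n)) cD).
  by apply/cvg_ex; exists delta.
have pos n t w : 0 <= t -> 0 <= elementary_capital (F n).1 (F n).2 t w.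
  by have [_ h _] := FP n; exact: h.
exists (PositiveCapitalProcess pos csum); split.
  rewrite /initial_capital /=; have <- : limn (series D) = delta by exact/cvg_lim.
  by apply: lim_series_le => //; apply/cvg_ex; exists delta.
move=> i w iw; have idxE : idx (pickle i) = i by rewrite /idx pickleK.
have [_ _ /(_ w)] := FP (pickle i); rewrite idxE => /(_ iw)[T Tw].
exists (Num.max T 0) => t; rewrite ge_max => /andP[Tt t0].
apply: (@le_trans _ _ (elementary_capital (F (pickle i)).1 (F (pickle i)).2 t w)%:E).
  by rewrite lee_fin Tw.
rewrite /capital (@nneseriesD1 _ _ (pickle i)) //=; last first.
  by move=> k _; rewrite lee_fin pos.
by rewrite leeDl// nneseries_ge0// => k _ _; rewrite lee_fin pos.
Qed.

End countable_cover.

Unset Implicit Arguments.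

Theorem theorem2 (R : realType) :
  upper_probability
    [set w : path_space R | exists t : R, 0 <= t /\
       (semi_strict_increase w t \/ semi_strict_decrease w t)] = 0%E.
Proof.
apply/eqP; rewrite eq_le; apply/andP; split; last first.
  apply: le_ereal_inf_tmp => _ [S _ <-]; rewrite lee_fin.
  exact: initial_capital_ge0.
apply/lee_addgt0Pr => e e0; rewrite add0e.
have [S [Se SP]] := covers_process e0.
apply: (@le_trans _ _ (initial_capital S)%:E); last by rewrite lee_fin.
apply: ereal_inf_lbound; exists S => // w /=.
rewrite indicE; case: (boolP (w \in _)) => [|_].
  rewrite inE => -[t [t0 /(semi_strict_covered t0)[i /SP[T]]]].
  exact: limf_einf_ge.
(* Off the event a nonnegative lower limit suffices, and positivity of the process gives it. *)
apply: (@limf_einf_ge _ _ _ 0) => t t0.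
by apply: nneseries_ge0 => n _ _; rewrite lee_fin; exact: elementary_capital_ge0.
Qed.
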